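(* Fix an ePBS game with $n\ge2$ builders and a separating stage-1 bid profile $\beta_1=(\beta_{i,1})_{i\in[n]}$ on value support $V\subseteq\mathbb R_+^n$. For $v\in V$ let $v_{(1)}\ge v_{(2)}$ be the highest and second-highest coordinates of $v$, let $M_{\beta_1}(v):=\max_{i\in[n]}\beta_{i,1}(v_i)$, and define $$\underline k_2(\beta_1):=\inf_{\{v\in V:\,v_{(1)}>0\}}k_1\frac{M_{\beta_1}(v)}{v_{(1)}},\qquad \bar k_2(\beta_1):=\inf_{\{v\in V:\,v_{(2)}>0\}}k_1\frac{M_{\beta_1}(v)}{v_{(2)}}.$$ Impose the non-overbidding constraint: any feasible terminal stage-2 bid satisfies $b_{i,2}\le v_i$. (i) If $k_2\le\underline k_2(\beta_1)$, then stopping is sequentially optimal for the proposer at every reached stage-1 history (every history generated by $\beta_1$ from some $v\in V$), regardless of the latency profile. (ii) If all builders are fast and $k_2>\bar k_2(\beta_1)$, then there is a reached stage-1 history at which continuation with full public disclosure is strictly better for the proposer than immediate stopping (for any sequentially rational continuation play). Moreover, suppose $\beta_1=\beta^{\mathrm{FPA}}$ is a pure symmetric strictly increasing efficient equilibrium of the one-shot first-price auction (FPA) on product support $V=\mathcal V^n$. Then $$\underline k_2(\beta^{\mathrm{FPA}})=\bar k_2(\beta^{\mathrm{FPA}})=k_2^\star(\beta^{\mathrm{FPA}}):=\inf_{\{x\in\mathcal V:\,x>0\}}k_1\frac{\beta^{\mathrm{FPA}}(x)}{x}.$$ Hence $k_2\le k_2^\star(\beta^{\mathrm{FPA}})$ makes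 immediate stopping sequentially optimal for the proposer at every reached FPA history, while $k_2>k_2^\star(\beta^{\mathrm{FPA}})$ rules out that immediate-stop FPA path when all builders are fast.
   Context: ePBS game. There are a proposer $P$ and $n$ builders, each publicly labelled fast or slow. Values $v=(v_1,\dots,v_n)$ are drawn from a commonly known joint distribution with support $V$; $B_i$ privately observes $v_i$ and submits a signed stage-1 bid $b_{i,1}\in\mathbb R_+$. The proposer observes the history $\mathcal E$ of all signed stage-1 bids and chooses STOP or CTN (continue). On CTN she sends messages $(m_c,m_1,\dots,m_n)$, each a subset of the verifiable bid history $\mathcal E$; $m_c$ is broadcast, $m_i$ is private to $B_i$. Full public disclosure means $m_c=\mathcal E$. A fast builder observes STOP/CTN, $m_c$ and $m_i$ before its stage-2 bid; a slow builder observes nothing new. Each builder then submits a stage-2 bid $b_{i,2}\ge b_{i,1}$. The terminal stage is $t=1$ after STOP, $t=2$ after CTN; the highest stage-$t$ bidder wins (symmetric tie-breaking) and pays its own bid; builder payoff is $k_t(v_i-b_{i,t})\mathbf 1\{i\text{ wins}\}$, proposer revenue is $k_t\max_ib_{i,t}$, with $k_1=1\ge k_2\ge0$. Builders' continuation play is sequentially rational given beliefs, and beliefs follow Bayes' rule at reached histories. A stage-1 bid profile is separating if each $\beta_{i,1}$ is a (pure) strictly increasing function of the value with $0\le\beta_{i,1}(v_i)\le v_i$, so that a stage-1 bid history reveals the values.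
   Formalization: In (ii), full public disclosure is shown strictly better for every private-message profile about which builders hold correct beliefs, and, without that condition, for some private-message profile that may depend on the play; for arbitrary off-path beliefs a fixed profile can fail. *)

(* Defs.v *)
From HB Require Import structures.
From mathcomp Require Import all_boot all_order all_algebra.
From mathcomp Require Import all_classical all_reals all_analysis.
From mathcomp Require Import measurable_realfun.

Set Implicit Arguments.
Unset Strict Implicit.
Unset Printing Implicit Defensive.

Import Order.TTheory GRing.Theory Num.Theory.

Local Open Scope classical_set_scope.
Local Open Scope ring_scope.

Definition profile (R : realType) (n : nat) : Type := n.-tuple R.
HB.instance Definition _ (R : realType) (n : nat) :=
  Measurable.copy (profile R n) (n.-tuple R).

Definition entry (R : realType) (n : nat) (v : profile R n) : 'I_n -> R :=
  tnth v.

Section IndependentLaw.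
Context (R : realType).

Definition consp (n : nat) (x : R * n.-tuple R) : n.+1.-tuple R :=
  [tuple of x.1 :: x.2].

Lemma measurable_consp (n : nat) : measurable_fun setT (@consp n).
Proof. exact: measurable_cons. Qed.

HB.instance Definition _ (n : nat) :=
  isMeasurableFun.Build _ _ _ _ (@consp n) (@measurable_consp n).

(* Joint law of independent draws, the i-th one from [P i]: see [indep_box]. *)
Fixpoint indep (n : nat) : ('I_n -> probability R R) ->
    probability (n.-tuple R) R :=
  match n with
  | 0 => fun _ => \d_([tuple])
  | m.+1 => fun P =>
      distribution (P ord0 \x indep (fun i => P (lift ord0 i)))%E (@consp m)
  end.

Lemma indep_box (n : nat) (P : 'I_n -> probability R R) (A : 'I_n -> set R) :
  (forall i, measurable (A i)) ->
  indep P [set b | forall i, A i (tnth b i)] = (\prod_(i < n) P i (A i))%E.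
Proof.
elim: n P A => [|n IHn] P A mA.
  rewrite big_ord0 /= diracE mem_set//=.
  by case.
rewrite big_ord_recl /= /distribution /= /pushforward.
have -> : @consp n @^-1` [set b | forall i, A i (tnth b i)] =
    A ord0 `*` [set b | forall i, A (lift ord0 i) (tnth b i)].
  apply/seteqP; split => -[x b] /=.
    move=> Ab; split; first exact: (Ab ord0).
    by move=> i /=; have := Ab (lift ord0 i); rewrite tnthS.
  move=> [A0 Ab] i; case: (unliftP ord0 i) => [j ->|->]; last exact: A0.
  by rewrite tnthS; exact: Ab.
rewrite product_measure1E//; first by rewrite -IHn.
rewrite (_ : [set _ | _] = \bigcap_(i in [set: 'I_n])
    ((fun b : n.-tuple R => tnth b i) @^-1` A (lift ord0 i))); last first.
  by apply/seteqP; split => [b Ab i _|b Ab i]; [exact: Ab|exact: (Ab i)].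
apply: fin_bigcap_measurable => // i _.
by rewrite -[X in measurable X]setTI; exact: (measurable_tnth i).
Qed.

End IndependentLaw.

Section Values.
Context (R : realType) (n : nat).

Definition supp (mu : probability (profile R n) R) : set (profile R n) :=
  [set v | forall e : R, 0 < e ->
    (0 < mu [set w : profile R n |
               forall i, (`|entry w i - entry v i| < e)%R])%E].

Definition supp_at (mu : probability (profile R n) R) (i : 'I_n) : set R :=
  [set entry v i | v in supp mu].

(* [order_stat v 0] is v_(1) and [order_stat v 1] is v_(2); ties are counted
   with multiplicity. *)
Definition order_stat (v : 'I_n -> R) (k : nat) : R :=
  nth 0 (sort >=%R [seq v i | i <- enum 'I_n]) k.

End Values.

Section Auction.
Context (R : realType) (n : nat).

(* Bids live in R_+, so starting the maximum at 0 is harmless. *)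
Definition max_bid (b : 'I_n -> R) : R := \big[Num.max/0]_(i < n) b i.

Definition winners (b : 'I_n -> R) : {set 'I_n} :=
  [set i : 'I_n | [forall j, b j <= b i]]%SET.

(* Probability that i wins under symmetric tie-breaking. *)
Definition share (b : 'I_n -> R) (i : 'I_n) : R :=
  (i \in winners b)%:R / #|winners b|%:R.

Definition upd (b : 'I_n -> R) (i : 'I_n) (y : R) : 'I_n -> R :=
  fun j => if j == i then y else b j.

Definition payoff (k v : R) (b : 'I_n -> R) (i : 'I_n) : R :=
  k * (v - b i) * share b i.

End Auction.

Section Game.
Context (R : realType) (n : nat).

Definition k1 : R := 1.

Definition history := 'I_n -> R.

(* A set of signed bids: [m j = Some x] says that it contains "builder j bid x".
   The subsets of the history h are the messages [disclose h S]. *)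
Definition message := 'I_n -> option R.

Definition disclose (h : history) (S : {set 'I_n}) : message :=
  fun j => if j \in S then Some (h j) else None.

(* [None] is STOP; [Some (Sc, Sp)] is CTN with m_c = disclose h Sc and
   m_i = disclose h (Sp i). *)
Definition decision : Type :=
  option ({set 'I_n} * {ffun 'I_n -> {set 'I_n}}).
HB.instance Definition _ := Finite.copy decision
  (option ({set 'I_n} * {ffun 'I_n -> {set 'I_n}})).

Definition stop : decision := None.

Definition full_disclosure (Sp : {ffun 'I_n -> {set 'I_n}}) : decision :=
  Some ([set: 'I_n]%SET, Sp).

Inductive signal :=
  | NoNews
  | SawStop
  | SawContinue (mc mi : message).

Definition observe (fast : 'I_n -> bool) (h : history) (a : decision)
    (i : 'I_n) : signal :=
  if fast i then
    match a with
    | None => SawStop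
    | Some (Sc, Sp) => SawContinue (disclose h Sc) (disclose h (Sp i))
    end
  else NoNews.

Record info := Info { own_value : R; own_bid : R; news : signal }.

(* The non-overbidding constraint bears on terminal bids only, hence on every
   information set that is compatible with CTN. *)
Definition feasible (I : info) : set R :=
  [set y : R | own_bid I <= y /\
    match news I with SawStop => True | _ => y <= own_value I end].

Definition hist (beta : 'I_n -> R -> R) (v : profile R n) : history :=
  fun i => beta i (entry v i).

Definition separating (mu : probability (profile R n) R)
    (beta : 'I_n -> R -> R) : Prop :=
  forall i : 'I_n,
    {in supp_at mu i &, {homo beta i : x y / x < y}} /\
    {in supp_at mu i, forall x, 0 <= beta i x <= x}.

Definition info_at (fast : 'I_n -> bool) (beta : 'I_n -> R -> R) (i : 'I_n)
    (v : profile R n) (a : decision) : info :=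
  Info (entry v i) (hist beta v i) (observe fast (hist beta v) a i).

(* Continuation play after the stage-1 profile: the proposer's (possibly mixed)
   choice at each history, the builders' (possibly mixed) stage-2 bids at each
   of their information sets, and the beliefs of all players.  Once stage 1 is
   played according to beta, a node is a pair (v, a): [bbelief i I a A] is the
   probability that builder i assigns at I to the event that the values lie in
   A and the proposer has chosen a. *)
Record assessment := Assessment {
  propose : history -> decision -> R;
  bid2 : 'I_n -> info -> probability R R;
  pbelief : history -> probability (profile R n) R;
  bbelief : 'I_n -> info -> decision ->
    {measure set (profile R n) -> \bar R} }.

Section Continuation.
Context (mu : probability (profile R n) R) (k2 : R) (fast : 'I_n -> bool).
Context (beta : 'I_n -> R -> R) (s : assessment).
Local Notation V := (supp mu).
Local Notation infoset i v a := (info_at fast beta i v a).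

Definition law2 (w : profile R n) (a : decision) : probability (profile R n) R :=
  indep (fun j => bid2 s j (infoset j w a)).

(* Builder i's expected payoff at the node (w, a) if its stage-2 bid is y. *)
Definition node_payoff (i : 'I_n) (y : R) (w : profile R n) (a : decision) :
    \bar R :=
  match a with
  | None => (payoff k1 (entry w i) (hist beta w) i)%:E
  | Some _ =>
      \int[law2 w a]_b (payoff k2 (entry w i) (upd (entry b) i y) i)%:E
  end.

Definition builder_payoff (i : 'I_n) (I : info) (y : R) : \bar R :=
  (\sum_(a : decision) \int[bbelief s i I a]_(w in V) node_payoff i y w a)%E.

Definition node_revenue (w : profile R n) (a : decision) : \bar R :=
  match a with
  | None => (k1 * max_bid (hist beta w))%:E
  | Some _ => \int[law2 w a]_b (k2 * max_bid (entry b))%:E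
  end.

Definition revenue (h : history) (a : decision) : \bar R :=
  (\int[pbelief s h]_(w in V) node_revenue w a)%E.

Definition proposer_optimal (h : history) (a : decision) : Prop :=
  forall a', (revenue h a' <= revenue h a)%E.

(* Bayes' rule in the form of a regular conditional distribution: for every
   event B about i's information set and every event (A, a') about the node,
   E[1_B . bbelief(I)(A, a')] = Pr(B and (A, a')), where v is drawn from mu and
   the decision from [propose s (hist beta v)]. *)
Definition bayes (i : 'I_n) : Prop :=
  forall (B : set info) (A : set (profile R n)) (a' : decision),
    measurable A ->
    (forall a, measurable (V `&` [set v | B (infoset i v a)])) ->
    (\sum_(a : decision) \int[mu]_(v in V `&` [set v | B (infoset i v a)])
        ((propose s (hist beta v) a)%:E * bbelief s i (infoset i v a) a' A) =
     \int[mu]_(v in V `&` A `&` [set v | B (infoset i v a')])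
        (propose s (hist beta v) a')%:E)%E.

(* Beliefs are formed at the information sets that follow the stage-1 histories
   generated by beta from V, and put all their mass on the nodes of the
   information set.  The proposer's information sets are singletons since beta
   is separating, so this already is Bayes' rule for her. *)
Record consistent : Prop := Consistent {
  propose_ge0 : forall h a, 0 <= propose s h a;
  propose_sum1 : forall h, \sum_(a : decision) propose s h a = 1;
  propose_meas : forall a,
    measurable_fun V (fun v => (propose s (hist beta v) a : R));
  bid2_meas : forall i a (A : set R), measurable A ->
    measurable_fun V (fun v => bid2 s i (infoset i v a) A : \bar R);
  bbelief_meas : forall i a a' (A : set (profile R n)), measurable A ->
    measurable_fun V (fun v => bbelief s i (infoset i v a) a' A : \bar R);
  bid2_feasible : forall i v a, V v ->
    bid2 s i (infoset i v a) (feasible (infoset i v a)) = 1%E;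
  pbelief_node : forall v, V v ->
    {ae pbelief s (hist beta v), forall w, V w /\ hist beta w = hist beta v};
  bbelief_sum1 : forall i v a, V v ->
    (\sum_(a' : decision) bbelief s i (infoset i v a) a' setT = 1)%E;
  bbelief_node : forall i v a a', V v ->
    {ae bbelief s i (infoset i v a) a',
      forall w, V w /\ infoset i w a' = infoset i v a};
  bbelief_bayes : forall i, bayes i }.

Definition builders_rational : Prop :=
  forall i v a (I := infoset i v a), V v -> forall y, feasible I y ->
    (builder_payoff i I y <=
     \int[bid2 s i I]_(x in feasible I) builder_payoff i I x)%E.

Definition rational_continuation : Prop := consistent /\ builders_rational.

(* After full public disclosure, private messages carry no further evidence
   about the history, but they remain privately observed.  This says that the
   builders are not mistaken about each other's private messages. *)
Definition messages_understood (v : profile R n) (a : decision) : Prop :=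
  forall i a', a' <> a -> bbelief s i (infoset i v a) a' setT = 0%E.

Definition immediate_stop : Prop :=
  forall v, V v -> propose s (hist beta v) stop = 1.

Definition proposer_rational : Prop :=
  forall v a, V v -> 0 < propose s (hist beta v) a ->
    proposer_optimal (hist beta v) a.

End Continuation.

Definition k2_lower (mu : probability (profile R n) R)
    (beta : 'I_n -> R -> R) : \bar R :=
  ereal_inf [set (k1 * (max_bid (hist beta v) / order_stat (entry v) 0))%:E
    | v in [set v | supp mu v /\ 0 < order_stat (entry v) 0]].

Definition k2_upper (mu : probability (profile R n) R)
    (beta : 'I_n -> R -> R) : \bar R :=
  ereal_inf [set (k1 * (max_bid (hist beta v) / order_stat (entry v) 1))%:E
    | v in [set v | supp mu v /\ 0 < order_stat (entry v) 1]].

Definition k2_star (VV : set R) (b : R -> R) : \bar R :=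
  ereal_inf [set (k1 * (b x / x))%:E | x in [set x | VV x /\ 0 < x]].

(* Bayes-Nash equilibrium of the one-shot first-price auction. *)
Definition fpa_equilibrium (mu : probability (profile R n) R)
    (beta : 'I_n -> R -> R) : Prop :=
  forall (i : 'I_n) (d : R -> R), measurable_fun setT d ->
    (forall x : R, 0 <= d x) ->
    (\int[mu]_(v in supp mu)
       (payoff k1 (entry v i) (upd (hist beta v) i (d (entry v i))) i)%:E <=
     \int[mu]_(v in supp mu) (payoff k1 (entry v i) (hist beta v) i)%:E)%E.

Definition efficient (mu : probability (profile R n) R)
    (beta : 'I_n -> R -> R) : Prop :=
  forall v, supp mu v -> forall i, i \in winners (hist beta v) ->
    forall j, entry v j <= entry v i.

End Game.

Arguments stop {n}.
Arguments full_disclosure {n} Sp.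

(* Main.v *)
(** Along separating bids the stage-1 history reveals the values, so after
    continuing the proposer faces an auction with known values.  Without
    overbidding it earns at most k2 v_(1), which gives (i).

    For (ii), full disclosure makes the values common knowledge among the
    builders, who may however be wrong about each other's private messages.
    View (builder, private messages) as finitely many types.  If every type bid
    below z = v_(2) with positive probability, every type of the two highest
    builders would have a positive equilibrium payoff.  Let l < z be the lowest
    point approached by their bids.  A type bidding near l wins with probability
    bounded away from 0, which forces an atom at l for some type of the other
    builder; that type wins at l only in a tie, and gains by bidding slightly
    more.  Hence some type bids at least z almost surely, and a disclosure that
    creates this type earns k2 v_(2), more than stopping. *)

Require Import Defs.
From mathcomp Require Import all_boot all_order all_algebra.
From mathcomp Require Import all_classical all_reals all_analysis.
From mathcomp Require Import measurable_realfun.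
From mathcomp Require Import lra ring.

Set Implicit Arguments.
Unset Strict Implicit.
Unset Printing Implicit Defensive.

Import Order.TTheory GRing.Theory Num.Theory.

Local Open Scope classical_set_scope.
Local Open Scope ring_scope.

(** * Integrals of arbitrary nonnegative functions *)

Section IntegralBounds.
Import HBNNSimple.
Context d (T : measurableType d) (R : realType).
Context (P : {measure set T -> \bar R}).

(* Unlike [ge0_le_integral], no measurability is required: the integral is a
   supremum over the simple functions below the integrand. *)
Lemma ge0_le_integral_sup (f g : T -> \bar R) :
  (forall x, 0 <= f x)%E -> (forall x, f x <= g x)%E ->
  (\int[P]_x f x <= \int[P]_x g x)%E.
Proof.
move=> f0 fg; have g0 x : (0 <= g x)%E by exact: le_trans (fg x).
rewrite !ge0_integralTE//; apply: ereal_sup_le => _ [h hf <-].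
by exists h => // x; exact: le_trans (fg x).
Qed.

(** Off the atom the integrand is dominated by [+oo] on a null set, which integrates to 0. This
    holds for arbitrary [V] and [g], the form in which payoffs are integrated against beliefs. *)
Lemma integral_point (V : set T) (v : T) (g : T -> \bar R) :
  measurable [set v] -> P (~` [set v]) = 0%E -> V v -> g v \is a fin_num ->
  (\int[P]_(w in V) g w = g v * P setT)%E.
Proof.
move=> mv Pv Vv gv.
have PT : P setT = P [set v].
  rewrite -(setUv [set v]) measureU//; last exact: setICr.
    by rewrite [X in (_ + X)%E]Pv adde0.
  exact: measurableC.
(* It is enough to treat the positive and negative parts; one of them vanishes at [v]. *)
suff pos (f : T -> \bar R) : (forall w, 0 <= f w)%E -> f v \is a fin_num ->
    (\int[P]_(w in V) f w = f v * P setT)%E.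
  rewrite integralE !pos// ?PT.
  - rewrite funeposE funenegE.
    have [g0|g0] := leP 0%E (g v).
      have gN : (- g v <= 0)%E by rewrite oppe_le0.
      by rewrite (max_idPr gN) mul0e sube0.
    have gN : (0 <= - g v)%E by rewrite oppe_ge0 ltW.
    by rewrite (max_idPl gN) mul0e sub0e mulNe oppeK.
  - by rewrite funenegE; case: (leP (- g v)%E 0%E) => //; rewrite fin_numN.
  - by rewrite funeposE; case: (leP (g v)%E 0%E).
move=> f0 fv; rewrite integral_mkcond.
have fV0 w : (0 <= (f \_ V) w)%E by rewrite patchE; case: ifP.
have intv c : (0 <= c)%E ->
    (\int[P]_w (c * (\1_[set v] w)%:E) = c * P [set v])%E.
  move=> c0; rewrite ge0_integralZl// ?integral_indic ?setIT//.
  exact/measurable_EFinP/measurable_indic.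
apply/eqP; rewrite eq_le PT; apply/andP; split; last first.
  rewrite -intv//; apply: ge0_le_integral_sup => w.
    by rewrite mule_ge0.
  rewrite indicE; have [->|wv] := eqVneq w v.
    by rewrite mem_set// mule1 patchE mem_set.
  by rewrite memNset ?mule0// => /eqP; apply/negP.
rewrite -[leRHS]adde0 -[X in (_ <= _ + X)%E](mule0 +oo%E) -Pv -intv//.
have -> : (+oo * P (~` [set v]) = \int[P]_w (+oo * (\1_(~` [set v]) w)%:E))%E.
  rewrite ge0_integralZl// ?integral_indic ?setIT//; first exact: measurableC.
  by apply/measurable_EFinP/measurable_indic; exact: measurableC.
rewrite -ge0_integralD//.
- apply: ge0_le_integral_sup => // w.
  have [->|wv] := eqVneq w v.
    rewrite !indicE mem_set// memNset; last by apply.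
    by rewrite mule1 mule0 adde0 patchE mem_set.
  rewrite !indicE memNset; last by move=> /eqP; apply/negP.
  by rewrite mem_set/= ?mule0 ?add0e ?mule1 ?leey//; move/eqP: wv.
- by move=> x _; rewrite mule_ge0.
- by apply: measurable_funeM; exact/measurable_EFinP/measurable_indic.
- apply: measurable_funeM; apply/measurable_EFinP.
  by apply: measurable_indic; exact: measurableC.
Qed.

End IntegralBounds.

(** * Bounds on expectations under a probability measure *)

Section ProbabilityBounds.
Context d (T : measurableType d) (R : realType) (P : probability T R).
Implicit Types (f : T -> R) (E N : set T).

Lemma probability_integral_bound f B : (forall x, 0 <= f x) -> (forall x, f x <= B) ->
  (0 <= \int[P]_x (f x)%:E <= B%:E)%E.
Proof.
move=> f0 fB; apply/andP; split; first by apply: integral_ge0 => x _; rewrite lee_fin.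
have -> : B%:E = (\int[P]_x (cst B%:E) x)%E.
  by rewrite integral_cst// [X in (_ * X)%E]probability_setT mule1.
by apply: ge0_le_integral_sup => x; rewrite lee_fin.
Qed.

Lemma probability_integral_fin f B : (forall x, 0 <= f x) -> (forall x, f x <= B) ->
  (\int[P]_x (f x)%:E)%E \is a fin_num.
Proof.
move=> f0 fB; have /andP[I0 IB] := probability_integral_bound f0 fB.
by rewrite ge0_fin_numE//; exact: le_lt_trans IB (ltry _).
Qed.

Lemma mulEFin_indic c E : 0 <= c -> measurable E ->
  (\int[P]_x (c * \1_E x)%:E = (c * fine (P E))%:E)%E.
Proof.
move=> c0 mE; under eq_integral do rewrite EFinM.
rewrite ge0_integralZl// ?integral_indic ?setIT//.
- by rewrite EFinM fineK// fin_num_measure.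
- exact/measurable_EFinP/measurable_indic.
Qed.

Lemma integral_ge_on f E c : (forall x, 0 <= f x) ->
  measurable E -> 0 <= c -> (forall x, E x -> c <= f x) ->
  ((c * fine (P E))%:E <= \int[P]_x (f x)%:E)%E.
Proof.
move=> f0 mE c0 cf; rewrite -mulEFin_indic//.
apply: ge0_le_integral_sup => x; rewrite lee_fin ?mulr_ge0// indicE.
by case: (boolP (x \in E)) => [/set_mem/cf|_]; rewrite ?mulr1 ?mulr0.
Qed.

(** The null set [N] collects the outcomes where the bound may fail; adding [+oo] on [N] to the
    majorant costs nothing. *)
Lemma integral_le_on f E N c : (forall x, 0 <= f x) ->
  measurable E -> measurable N -> P N = 0%E -> 0 <= c ->
  (forall x, ~ N x -> E x -> f x <= c) -> (forall x, ~ E x -> f x <= 0) ->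
  (\int[P]_x (f x)%:E <= (c * fine (P E))%:E)%E.
Proof.
move=> f0 mE mN PN c0 fc fE.
rewrite -[leRHS]adde0 -[X in (_ <= _ + X)%E](mule0 +oo%E) -PN.
have -> : (+oo * P N = \int[P]_x (+oo * (\1_N x)%:E))%E.
  rewrite ge0_integralZl// ?integral_indic ?setIT//.
  exact/measurable_EFinP/measurable_indic.
rewrite -mulEFin_indic// -ge0_integralD//.
- apply: ge0_le_integral_sup => x; rewrite ?lee_fin// !indicE.
  case: (boolP (x \in N)) => [_|/negP xN].
    by rewrite mule1 addey ?leey.
  rewrite mule0 adde0 lee_fin.
  case: (boolP (x \in E)) => [/set_mem xE|/negP xE].
    by rewrite mulr1; apply: fc => //; contra: xN => /mem_set.
  by rewrite mulr0; apply: fE; contra: xE => /mem_set.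
- by move=> x _; rewrite lee_fin mulr_ge0.
- by apply/measurable_EFinP; apply: measurable_funM => //; exact: measurable_indic.
- by apply: measurable_funeM; exact/measurable_EFinP/measurable_indic.
Qed.

(* A mixture over D attaining the supremum of U attains values close to the
   supremum on every event of positive probability. *)
Lemma optimal_near (D A : set T) (U : T -> R) (B c : R) (y0 : T) :
  measurable D -> measurable A -> P D = 1%E -> (0 < P A)%E ->
  (forall y, D y -> 0 <= U y <= B) ->
  (forall y, D y -> (U y)%:E <= \int[P]_(x in D) (U x)%:E)%E ->
  D y0 -> 0 <= c < U y0 -> exists y, [/\ D y, A y & c < U y].
Proof.
move=> mD mA PD PA UB Uopt Dy0 /andP[c0 cU].
apply: contrapT => noy.
have Uc y : D y -> A y -> U y <= c.
  by move=> Dy Ay; rewrite leNgt; apply/negP => cy; apply: noy; exists y.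
pose f x := if x \in D then U x else 0.
have fE : (\int[P]_(x in D) (U x)%:E = \int[P]_x (f x)%:E)%E.
  by rewrite integral_mkcond; apply: eq_integral => x _; rewrite /f patchE; case: ifP.
have f0 x : 0 <= f x.
  by rewrite /f; case: ifP => // /set_mem/UB/andP[].
have fB x : f x <= B.
  rewrite /f; case: ifP => [/set_mem/UB/andP[]//|_].
  by case/andP: (UB _ Dy0); exact: le_trans.
have If := probability_integral_fin f0 fB.
set r := fine (\int[P]_x (f x)%:E)%E.
have rE : (\int[P]_x (f x)%:E)%E = r%:E by rewrite fineK.
have Ur y : D y -> U y <= r by move=> /Uopt; rewrite fE rE lee_fin.
have rc : c < r by exact: lt_le_trans (Ur _ Dy0).
have PDA : P (D `&` A) = P A.
  apply/eqP; rewrite eq_le le_measure ?inE//=; last exact: measurableI.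
  have /eqP PDC0 : P (~` D) == 0%E.
    by rewrite probability_setC// PD subee.
  have mDC := measurableC mD; have mDA := measurableI _ _ mD mA.
  have := le_measure P; move/(_ A ((D `&` A) `|` ~` D)); rewrite !inE.
  move=> /(_ mA (measurableU _ _ mDA mDC)) H; apply: le_trans (H _) _.
    by move=> x Ax /=; have [Dx|nDx] := pselect (D x); [left|right].
  apply: le_trans (measureU2 _ _ _) _ => //.
  by rewrite [X in (_ + X <= _)%E]PDC0 adde0.
(* The mean [r] of [U] would be at most an average of [c] and [r] that gives [c < r] the positive
   weight [P A]. *)
suff : (r%:E <= (c * fine (P A) + r * fine (P (D `\` A)))%:E)%E.
  rewrite lee_fin leNgt => /negP; apply.
  have Asum : fine (P A) + fine (P (D `\` A)) = 1.
    rewrite -fineD ?fin_num_measure//; last exact: measurableD.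
    rewrite -PDA -measureU//; [|exact: measurableI|exact: measurableD|]; last first.
      by rewrite setDE setIACA setICr setI0.
    by rewrite setDE -setIUr setUv setIT [X in fine X]PD.
  have pA : 0 < fine (P A) by rewrite fine_gt0// PA/= ltey_eq fin_num_measure.
  nra.
rewrite -rE EFinD -PDA -!mulEFin_indic//;
  [|exact: le_trans (ltW rc)|exact: measurableD|exact: measurableI].
have ? := measurableI _ _ mD mA; have ? := measurableD mD mA.
rewrite -ge0_integralD//.
- apply: ge0_le_integral_sup => x; rewrite -?EFinD lee_fin//= /f !indicE in_setD in_setI.
  case: ifPn => [/set_mem Dx|_]; last by rewrite !mulr0 addr0.
  case: (boolP (x \in A)) => [/set_mem Ax|_] /=; first by rewrite mulr1 mulr0 addr0 Uc.
  by rewrite mulr1 mulr0 add0r Ur.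
- by move=> x _; rewrite lee_fin mulr_ge0.
- by apply/measurable_EFinP; apply: measurable_funM => //; exact: measurable_indic.
- by move=> x _; rewrite lee_fin mulr_ge0// (le_trans c0)// ltW.
- by apply/measurable_EFinP; apply: measurable_funM => //; exact: measurable_indic.
Qed.

End ProbabilityBounds.

(** * Lower tails of a law on the real line: one-sided continuity and atoms *)

Section Tails.
Context (R : realType) (P : probability R R).

Lemma lower_tail_le (s t : R) : s <= t -> (P `]-oo, s]%classic <= P `]-oo, t]%classic)%E.
Proof. by move=> st; rewrite le_measure ?inE//; exact: subitvPr. Qed.

Lemma lower_tail_left_eq0 (t : R) :
  (forall s, s < t -> P `]-oo, s]%classic = 0%E) -> P `]-oo, t[%classic = 0%E.
Proof.
move=> P0.
have /negligible_bigcup : forall k, P.-negligible `]-oo, t - k.+1%:R^-1]%classic.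
  move=> k; exists `]-oo, t - k.+1%:R^-1]%classic; split => //.
  by apply: P0; rewrite ltrBlDr ltrDl invr_gt0.
case=> B [mB PB sB]; apply/eqP; rewrite -measure_le0 -PB le_measure ?inE//.
apply: subset_trans sB => s /=; rewrite in_itv/= => st.
have [k kst] := ltr_add_invr st; exists k => //=.
by rewrite in_itv/= lerBrDr ltW.
Qed.

(** Right continuity of the distribution function: continuity from above along [t + k.+1%:R^-1]
    gives one point, monotonicity the whole right neighbourhood. *)
Lemma lower_tail_right_lt (t e : R) : (P `]-oo, t]%classic < e%:E)%E ->
  \forall s \near t^'+, (P `]-oo, s]%classic < e%:E)%E.
Proof.
move=> Pt; suff [k Pk] : exists k : nat, (P `]-oo, (t + k.+1%:R^-1)%R]%classic < e%:E)%E.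
  have tk : t < t + k.+1%:R^-1 by rewrite ltrDl invr_gt0.
  near=> s; apply: le_lt_trans Pk; apply: lower_tail_le.
  by near: s; exact: nbhs_right_ltW.
apply: contrapT => /forallNP noP; move: Pt; apply/negP; rewrite -leNgt.
rewrite (itvNycEbigcap false).
pose F (k : nat) := `]-oo, (t + k.+1%:R^-1)%R]%classic.
have : P \o F @ \oo --> P (\bigcap_k F k).
  apply: nonincreasing_cvg_mu => //.
  - apply: (@le_lt_trans _ _ 1%E); last exact: ltry.
    by apply: probability_le1; exact: measurable_itv.
  - by move=> k; exact: measurable_itv.
  - by rewrite -(itvNycEbigcap false).
  - move=> a b ab; apply/subsetPset; apply: subitvPr.
    by rewrite bnd_simp lerD2l lef_pV2 ?posrE// ler_nat ltnS.
apply: cvge_ge; apply: nearW => k /=.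
by rewrite leNgt; apply/negP; exact: noP.
Unshelve. all: by end_near. Qed.

Lemma lower_tail_atom (t : R) : P `]-oo, t[%classic = 0%E ->
  P `]-oo, t]%classic = P [set t].
Proof.
move=> Pt; rewrite -(@setUitv1 _ _ -oo%O t true)// measureU//.
  by rewrite [X in (X + _)%E]Pt add0e.
by rewrite -subset0 => s [/= + st]; rewrite st in_itv/= ltxx.
Qed.

End Tails.

(** * Winning probabilities after a unilateral change of bid *)

Section Shares.
Context (R : realType) (n : nat).
Implicit Types (b : 'I_n -> R) (i j : 'I_n) (y : R).

Lemma updE b i y : upd b i y i = y. Proof. by rewrite /upd eqxx. Qed.

Lemma upd_neq b i j y : j != i -> upd b i y j = b j.
Proof. by rewrite /upd => /negPf ->. Qed.

Lemma share_ge0 b i : 0 <= share b i. Proof. by rewrite divr_ge0. Qed.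

Lemma share_le1 b i : share b i <= 1.
Proof.
rewrite /share; case: (boolP (i \in winners b)) => [iw|_]; last by rewrite mul0r.
have w0 : (0 < #|winners b|)%N by apply/card_gt0P; exists i.
by rewrite ler_pdivrMr ?ltr0n// mul1r ler1n.
Qed.

Lemma share_top b i y : (forall j, j != i -> b j < y) -> share (upd b i y) i = 1.
Proof.
move=> by_; rewrite /share.
have -> : winners (upd b i y) = [set i]%SET.
  apply/setP => j; rewrite !inE; apply/forallP/eqP => [|-> l]; last first.
    have [->//|li] := eqVneq l i; rewrite updE upd_neq// ltW// by_//.
  move=> /(_ i); rewrite updE; apply: contraTeq => ji.
  by rewrite upd_neq// -ltNge by_.
by rewrite set11 cards1 divr1.
Qed.

Lemma share_out b i j y : j != i -> y < b j -> share (upd b i y) i = 0.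
Proof.
move=> ji yb; rewrite /share [_ \in _](_ : _ = false) ?mul0r//.
by rewrite inE; apply/forallP => /(_ j); rewrite updE upd_neq// leNgt yb.
Qed.

(** If [i] wins at all, the tied [j] wins as well, so the prize is split at least two ways. *)
Lemma share_tie b i j y : j != i -> b j = y -> share (upd b i y) i <= 2^-1.
Proof.
move=> ji bj; rewrite /share; case: (boolP (_ \in _)) => [iw|_]; last first.
  by rewrite mul0r invr_ge0.
rewrite mul1r lef_pV2 ?posrE ?ler_nat ?ltr0n//; last first.
  by apply/card_gt0P; exists i.
rewrite (_ : 2%N = #|[set i; j]%SET|); last by rewrite cards2 eq_sym ji.
apply/subset_leq_card/fintype.subsetP => l; rewrite !inE => /orP[]/eqP -> //.
  by move: iw; rewrite inE.
apply/forallP => l'; rewrite (upd_neq _ _ ji) bj.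
by move: iw; rewrite inE => /forallP/(_ l'); rewrite updE.
Qed.

End Shares.

(** * Boxes and slabs of bid vectors *)

Section Boxes.
Context (R : realType) (n : nat).

Lemma measurable_box (A : 'I_n -> set R) : (forall i, measurable (A i)) ->
  measurable [set b : n.-tuple R | forall i, A i (tnth b i)].
Proof.
move=> mA; rewrite (_ : [set _ | _] = \bigcap_(i in [set: 'I_n])
    ((fun b : n.-tuple R => tnth b i) @^-1` A i)); last first.
  by apply/seteqP; split => [b Ab i _|b Ab i]; [exact: Ab|exact: (Ab i)].
apply: fin_bigcap_measurable => // i _.
by rewrite -[X in measurable X]setTI; exact: (measurable_tnth i).
Qed.

Lemma measurable_slab (i : 'I_n) (A : set R) : measurable A ->
  measurable [set b : n.-tuple R | A (tnth b i)].
Proof.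
by move=> mA; rewrite -[X in measurable X]setTI; exact: (measurable_tnth i).
Qed.

Lemma indep_slab (P : 'I_n -> probability R R) (i : 'I_n) (A : set R) :
  measurable A -> indep P [set b | A (tnth b i)] = P i A.
Proof.
move=> mA; pose B j := if j == i then A else setT.
rewrite (_ : [set _ | _] = [set b | forall j, B j (tnth b j)]); last first.
  apply/seteqP; split => b /= => [Ab j|/(_ i)]; last by rewrite /B eqxx.
  by rewrite /B; case: eqP => [->|].
rewrite indep_box; last by move=> j; rewrite /B; case: ifP.
rewrite (bigD1 i)//= /B eqxx big1 ?mule1// => j /negPf ->.
exact: probability_setT.
Qed.

Lemma measurable_set1_tuple (v : n.-tuple R) : measurable [set v].
Proof.
rewrite (_ : [set v] = [set b | forall i, [set tnth v i] (tnth b i)]); last first.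
  apply/seteqP; split => b /=; [by move=> ->|move=> bv].
  by apply: eq_from_tnth.
by apply: (measurable_box (A := fun i => [set tnth v i])) => i; exact: measurable_set1.
Qed.

End Boxes.

(** * Complete-information bidding with arbitrary beliefs over messages *)

Section ExpectedPayoff.
Context (R : realType) (n : nat) (P : 'I_n -> probability R R).
Context (k v : R) (i : 'I_n) (y : R).

(** On this event any bid of [i] above [c] wins outright; the coordinate [i] is left free because
    [upd] overwrites it. *)
Definition rivals_le (c : R) : set (n.-tuple R) :=
  [set b | forall j, j != i -> tnth b j <= c].

Lemma rivals_leE c : rivals_le c =
  [set b | forall j, (if j == i then setT else `]-oo, c]%classic) (tnth b j)].
Proof.
apply/seteqP; split => b /= bc j.
  by case: eqP => // /eqP ji; rewrite /= in_itv/= bc.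
by move=> /negPf ji; have := bc j; rewrite ji /= in_itv.
Qed.

Lemma measurable_rivals_le c : measurable (rivals_le c).
Proof.
rewrite rivals_leE; pose A j := if j == i then setT else `]-oo, c]%classic.
by apply: (measurable_box (A := A)) => j; rewrite /A; case: ifP.
Qed.

Lemma rivals_le_gt0 c : (forall j, (0 < P j `]-oo, c]%classic)%E) ->
  0 < fine (indep P (rivals_le c)).
Proof.
move=> P0; rewrite fine_gt0//; apply/andP; split; last first.
  by rewrite -ge0_fin_numE// fin_num_measure//; exact: measurable_rivals_le.
pose A j := if j == i then setT else `]-oo, c]%classic.
rewrite rivals_leE (@indep_box _ _ P A); last first.
  by move=> j; rewrite /A; case: ifP.
elim/big_ind : _ => // [a b|j _]; first exact: mule_gt0.
by rewrite /A; case: ifP => // _; rewrite probability_setT.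
Qed.

Definition expected_payoff : \bar R :=
  (\int[indep P]_b (payoff k v (upd (tnth b) i y) i)%:E)%E.

Context (k_ge0 : 0 <= k) (y_le_v : y <= v).

Let won (b : n.-tuple R) : R := payoff k v (upd (tnth b) i y) i.

Let stake_ge0 : 0 <= k * (v - y). Proof. by rewrite mulr_ge0// subr_ge0. Qed.

Lemma payoff_updE (b : 'I_n -> R) :
  payoff k v (upd b i y) i = k * (v - y) * share (upd b i y) i.
Proof. by rewrite /payoff updE. Qed.

Lemma payoff_upd_ge0 (b : 'I_n -> R) : 0 <= payoff k v (upd b i y) i.
Proof. by rewrite payoff_updE mulr_ge0// share_ge0. Qed.

Lemma payoff_upd_le (b : 'I_n -> R) : payoff k v (upd b i y) i <= k * (v - y).
Proof. by rewrite payoff_updE ler_piMr// share_le1. Qed.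

Lemma expected_payoff_bound : (0 <= expected_payoff <= (k * (v - y))%:E)%E.
Proof.
by apply: (probability_integral_bound _ (f := won)) => b;
  [exact: payoff_upd_ge0|exact: payoff_upd_le].
Qed.

Lemma expected_payoff_fin : expected_payoff \is a fin_num.
Proof.
by apply: (probability_integral_fin _ (f := won)) => b;
  [exact: payoff_upd_ge0|exact: payoff_upd_le].
Qed.

Lemma expected_payoff_ge c : c < y ->
  k * (v - y) * fine (indep P (rivals_le c)) <= fine expected_payoff.
Proof.
move=> cy; rewrite -lee_fin fineK ?expected_payoff_fin//.
apply: (integral_ge_on _ (f := won)) => //.
- by move=> b; exact: payoff_upd_ge0.
- exact: measurable_rivals_le.
- move=> b bc; rewrite /won payoff_updE share_top ?mulr1// => j ji.
  exact: le_lt_trans (bc j ji) cy.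
Qed.

Lemma expected_payoff_le j : j != i ->
  fine expected_payoff <= k * (v - y) * fine (P j `]-oo, y]%classic).
Proof.
move=> ji; rewrite -lee_fin fineK ?expected_payoff_fin//.
rewrite -(indep_slab P j); last exact: measurable_itv.
apply: (@integral_le_on _ _ _ _ won _ set0) => //.
- by move=> b; exact: payoff_upd_ge0.
- by apply: measurable_slab; exact: measurable_itv.
- by move=> b _ _; exact: payoff_upd_le.
- move=> b /= /negP; rewrite in_itv/= -ltNge => yb.
  by rewrite /won payoff_updE (share_out ji yb) mulr0.
Qed.

(** Almost surely [j] bids at least [y], so [i] can win with [y] only by tying with [j]. The factor
    one half, against the full share in [expected_payoff_ge], is what makes a slight raise
    profitable. *)
Lemma expected_payoff_tie j : j != i -> P j `]-oo, y[%classic = 0%E ->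
  fine expected_payoff <= k * (v - y) / 2 * fine (indep P (rivals_le y)).
Proof.
move=> ji Pj0; rewrite -lee_fin fineK ?expected_payoff_fin//.
apply: (@integral_le_on _ _ _ _ won _
  [set b | `]-oo, y[%classic (tnth b j)]) => //.
- by move=> b; exact: payoff_upd_ge0.
- exact: measurable_rivals_le.
- by apply: measurable_slab; exact: measurable_itv.
- by rewrite indep_slab//; exact: measurable_itv.
- by rewrite divr_ge0.
- move=> b /= /negP; rewrite in_itv/= -leNgt => yb bc.
  rewrite /won payoff_updE ler_wpM2l// (share_tie ji)//.
  by apply/eqP; rewrite eq_le yb bc.
- move=> b /= /existsNP[l /not_implyP[li /negP]]; rewrite -ltNge => yb.
  by rewrite /won payoff_updE (share_out li yb) mulr0.
Qed.

End ExpectedPayoff.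

(** * Bertrand competition between two high-value builders over finitely many types *)

Section Bertrand.
Context (R : realType) (n : nat) (D : finType) (T : {set D}).
Context (F : D -> 'I_n -> probability R R) (m : 'I_n -> D -> D -> R).
Context (x lo : 'I_n -> R) (k z : R) (i1 i2 : 'I_n).

(* [m i a a'] is the weight that builder i, at the information set following
   the decision a, puts on the decision a'; the weights need not come from a
   common prior. *)
Definition gain (i : 'I_n) (a : D) (y : R) : R :=
  \sum_(a' : D) m i a a' * fine (expected_payoff (F a') k (x i) i y).

Context (k_gt0 : 0 < k) (i12 : i1 != i2) (T_neq0 : exists a, a \in T).
Context (z_i1 : z <= x i1) (z_i2 : z <= x i2) (lo_z : forall i, lo i < z).
Context (m_ge0 : forall i a a', 0 <= m i a a').
Context (m_out : forall i a a', a \in T -> a' \notin T -> m i a a' = 0).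
Context (m_sum1 : forall i a, a \in T -> \sum_(a' : D) m i a a' = 1).
Context (F_feasible : forall i a, a \in T -> F a i `[lo i, x i]%classic = 1%E).
Context (F_optimal : forall i a, a \in T -> forall y, y \in `[lo i, x i] ->
  ((gain i a y)%:E <= \int[F a i]_(t in `[lo i, x i]) (gain i a t)%:E)%E).

Let top : pred 'I_n := pred2 i1 i2.

Let top_le i : top i -> z <= x i. Proof. by case/pred2P => ->. Qed.

Let rival i : top i -> exists2 j, top j & j != i.
Proof.
case/pred2P => ->; [exists i2|exists i1] => //.
- by rewrite /top/= eqxx orbT.
- by rewrite eq_sym.
- by rewrite /top/= eqxx.
Qed.

Let gain_ge i a c y : c < y -> y <= x i ->
  k * (x i - y) * (\sum_(a' : D) m i a a' * fine (indep (F a') (rivals_le i c)))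
  <= gain i a y.
Proof.
move=> cy yx; rewrite mulr_sumr; apply: ler_sum => a' _.
rewrite mulrCA ler_wpM2l//; apply: expected_payoff_ge => //; exact: ltW.
Qed.

Let gain_bound i a y : a \in T -> y \in `[lo i, x i] ->
  0 <= gain i a y <= k * (x i - lo i).
Proof.
move=> aT; rewrite in_itv/= => /andP[ly yx].
have bnd a' : 0 <= fine (expected_payoff (F a') k (x i) i y) <= k * (x i - lo i).
  have k0 := ltW k_gt0.
  have := expected_payoff_bound (F a') i k0 yx.
  rewrite -[expected_payoff _ _ _ _ _]fineK ?expected_payoff_fin// !lee_fin.
  case/andP => -> /le_trans/=; apply; rewrite ler_wpM2l//.
  by rewrite lerD2l lerN2.
apply/andP; split.
  by apply: sumr_ge0 => a' _; rewrite mulr_ge0//; case/andP: (bnd a').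
rewrite -[leRHS]mul1r -(m_sum1 i aT) mulr_suml; apply: ler_sum => a' _.
by rewrite ler_wpM2l//; case/andP: (bnd a').
Qed.

(** An optimal mixed bid charges no set of bids that are all bounded away from the best payoff; this
    is [optimal_near] for [F a i] and [gain i a]. *)
Let near_optimal i a (A : set R) y0 c : a \in T -> measurable A ->
  (0 < F a i A)%E -> y0 \in `[lo i, x i] -> 0 <= c < gain i a y0 ->
  exists y, [/\ y \in `[lo i, x i], A y & c < gain i a y].
Proof.
move=> aT mA FA y0f cy0.
have := @optimal_near _ _ _ (F a i) `[lo i, x i]%classic A (gain i a)
  (k * (x i - lo i)) c y0.
apply => //.
- exact: F_feasible.
- by move=> y; exact: gain_bound.
- by move=> y; exact: F_optimal.
Qed.

(** * Refutation of the case where every type bids below [z] with positive probability *)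

Section NoCertainBid.
Context (F_below : forall i a, a \in T -> F a i `]-oo, z[%classic != 0%E).

(** Each type charges some closed half-line ending below [z]. There are finitely many types, so the
    maximum of these end points and of the [lo i] is still below [z]. *)
Let common_level : exists2 c, c < z &
  (forall i, lo i <= c) /\ (forall i a, a \in T -> (0 < F a i `]-oo, c]%classic)%E).
Proof.
have /choice[f fP] (ai : D * 'I_n) : exists c, c < z /\
    (ai.1 \in T -> 0 < F ai.1 ai.2 `]-oo, c]%classic)%E.
  case: (boolP (ai.1 \in T)) => aT; last by exists (lo i1).
  apply: contrapT => nc; case/eqP: (F_below ai.2 aT).
  apply: lower_tail_left_eq0 => s sz; apply/eqP.
  rewrite -measure_le0 leNgt; apply/negP => Fs; apply: nc.
  by exists s.
pose c := \big[Num.max/lo i1]_(ai : D * 'I_n) Num.max (f ai) (lo ai.2).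
have cmax ai : Num.max (f ai) (lo ai.2) <= c by exact: le_bigmax.
exists c.
  apply/bigmax_ltP; split => // ai _.
  by rewrite gt_max lo_z andbT; case: (fP ai).
have [a0 _] := T_neq0.
split => i; first by rewrite (le_trans _ (cmax (a0, i)))// le_max lexx orbT.
move=> a aT; apply: lt_le_trans ((fP (a, i)).2 aT) _; apply: lower_tail_le.
by rewrite (le_trans _ (cmax (a, i)))// le_max lexx.
Qed.

(** Only the two top builders enter, since a value of at least [z] guarantees them a positive margin
    on every bid below [z]. *)
Let lower_bids : set R :=
  [set t | exists i a, [/\ top i, a \in T & (0 < F a i `]-oo, t]%classic)%E]].

Let l := inf lower_bids.

Let feasible_ge i a t : a \in T -> (0 < F a i `]-oo, t]%classic)%E -> lo i <= t.
Proof.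
move=> aT Ft; rewrite leNgt; apply/negP => tlo; move: Ft; apply/negP.
rewrite -leNgt -(_ : F a i (~` `[lo i, x i]%classic) = 0%E).
  rewrite le_measure ?inE//; first exact: measurableC.
  move=> s /=; rewrite !in_itv/= => st /andP[los _].
  by have := le_lt_trans (le_trans los st) tlo; rewrite ltxx.
by rewrite probability_setC// F_feasible// subee.
Qed.

Let lb_lower_bids : has_inf lower_bids.
Proof.
have [c cz [loc Fc]] := common_level; have [a aT] := T_neq0.
split; first by exists c, i1, a; split; rewrite /top/= ?eqxx//; exact: Fc.
exists (Num.min (lo i1) (lo i2)) => t [i [b [ti bT Ft]]].
have := feasible_ge bT Ft; rewrite ge_min.
by case/pred2P: ti => -> ->; rewrite ?orbT.
Qed.

Let l_le t : lower_bids t -> l <= t.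
Proof. by move=> tS; apply: ge_inf => //; case: lb_lower_bids. Qed.

Let below_l i a : top i -> a \in T -> F a i `]-oo, l[%classic = 0%E.
Proof.
move=> ti aT; apply: lower_tail_left_eq0 => s sl; apply/eqP.
rewrite -measure_le0 leNgt; apply/negP => Fs.
by have := l_le (ex_intro _ i (ex_intro _ a (And3 ti aT Fs))); rewrite leNgt sl.
Qed.

(** If every top type had no mass up to some point beyond [l], a point beyond [l] would serve for
    all of these finitely many types and contradict the infimum. *)
Let approach_l : exists i a, [/\ top i, a \in T &
  forall t, l < t -> (0 < F a i `]-oo, t]%classic)%E].
Proof.
apply: contrapT => nia.
have N (ai : D * 'I_n) : top ai.2 -> ai.1 \in T ->
    exists2 t, l < t & F ai.1 ai.2 `]-oo, t]%classic = 0%E.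
  move=> ti aT; apply: contrapT => nt; apply: nia.
  exists ai.2, ai.1; split => // t lt; rewrite lt0e measure_ge0 andbT.
  by apply/eqP => Ft; apply: nt; exists t.
have : \forall t \near l^'+, forall ai : D * 'I_n, top ai.2 -> ai.1 \in T ->
    F ai.1 ai.2 `]-oo, t]%classic = 0%E.
  apply: filter_forall => ai.
  case: (boolP (top ai.2 && (ai.1 \in T))) => [/andP[ti aT]|nai]; last first.
    by apply: nearW => t ti aT; rewrite ti aT in nai.
  have [t lt Ft] := N _ ti aT; near=> s => _ _; apply/eqP.
  rewrite -measure_le0 -Ft; apply: lower_tail_le.
  by near: s; exact: nbhs_right_ltW.
move=> H.
have [t [lt Ft]] : exists t, l < t /\ forall ai : D * 'I_n, top ai.2 -> ai.1 \in T ->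
    F ai.1 ai.2 `]-oo, t]%classic = 0%E.
  near l^'+ => t; exists t; split; last by near: t.
  by near: t; exact: nbhs_right_gt.
have tl : 0 < t - l by rewrite subr_gt0.
have [s [i [a [ti aT Fs]]]] := inf_adherent tl lb_lower_bids.
rewrite -/l addrC subrK => st; move: Fs; apply/negP; rewrite -leNgt.
by rewrite -(Ft (a, i) ti aT); apply: lower_tail_le; exact: ltW.
Unshelve. all: by end_near. Qed.

(** The bid halfway between the common level [c] and [z] beats rivals who all bid at most [c], an
    event of positive probability at every decision in [T], and leaves a positive margin. *)
Let positive_gain : exists2 y0, l < y0 < z &
  forall i a, top i -> a \in T -> y0 \in `[lo i, x i] /\ 0 < gain i a y0.
Proof.
have [c cz [loc Fc]] := common_level; have [a0 a0T] := T_neq0.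
have lc : l <= c by apply: l_le; exists i1, a0; split; rewrite /top/= ?eqxx//; exact: Fc.
have cy : c < (c + z) / 2 by rewrite midf_lt.
have yz : (c + z) / 2 < z by rewrite midf_lt.
exists ((c + z) / 2); first by rewrite yz (le_lt_trans lc).
move=> i a ti aT; have zx := top_le ti; have yx := ltW (lt_le_trans yz zx).
split; first by rewrite in_itv/= yx (le_trans (loc i))// ltW.
apply: lt_le_trans (gain_ge a cy yx).
rewrite mulr_gt0//; first by rewrite mulr_gt0// subr_gt0 (lt_le_trans yz).
rewrite lt_neqAle sumr_ge0 ?andbT; last first.
  by move=> a' _; rewrite mulr_ge0// fine_ge0.
apply/eqP => /esym/eqP; rewrite psumr_eq0; last first.
  by move=> a' _; rewrite mulr_ge0// fine_ge0.
move=> /allP m0; have : \sum_(a' : D) m i a a' = 0.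
  apply: big1 => a' _.
  case: (boolP (a' \in T)) => [a'T|]; last exact: m_out.
  have := m0 a' (mem_index_enum _); rewrite mulf_eq0 => /orP[/eqP//|].
  by rewrite gt_eqF// rivals_le_gt0// => j; exact: Fc.
by rewrite m_sum1// => /eqP; rewrite oner_eq0.
Qed.

(** A type approaching [l] has bids arbitrarily near [l] that earn more than half of [gain i a y0].
    Without an atom of the rival at [l], right continuity would make the chance of winning there
    arbitrarily small, at all decisions in [T] at once. *)
Let atom_l : exists j a, [/\ top j, a \in T & (0 < F a j [set l])%E].
Proof.
have [i [a [ti aT Fi]]] := approach_l.
have [y0 /andP[ly0 y0z] /(_ i a ti aT)[y0f g0]] := positive_gain.
have [j tj ji] := rival ti.
apply: contrapT => nja.
pose K := k * (x i - lo i).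
have K0 : 0 < K by rewrite mulr_gt0// subr_gt0 (lt_le_trans (lo_z i))// top_le.
(* Chosen so that [K * e], which will bound the payoff near [l], is half of [gain i a y0]. *)
pose e := gain i a y0 / 2 / K.
have e0 : 0 < e by rewrite divr_gt0// divr_gt0.
have : \forall t \near l^'+, forall a', a' \in T -> (F a' j `]-oo, t]%classic < e%:E)%E.
  apply: filter_forall => a'.
  case: (boolP (a' \in T)) => a'T; last exact: nearW.
  have := @lower_tail_right_lt _ (F a' j) l e.
  rewrite lower_tail_atom ?below_l// => H; near=> t => _; near: t; apply: H.
  rewrite ltNge; apply/negP => eF; apply: nja; exists j, a'; split => //.
  exact: lt_le_trans eF.
move=> H; near l^'+ => t.
have lt : l < t by near: t; exact: nbhs_right_gt.
have Ft a' : a' \in T -> (F a' j `]-oo, t]%classic < e%:E)%E.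
  by move: a'; near: t.
have [||y [yf /=]] := @near_optimal i a `]-oo, t]%classic y0
  (gain i a y0 / 2) aT _ (Fi t lt) y0f.
- exact: measurable_itv.
- by rewrite divr_ge0 ?ltW//= ltr_pdivrMr// ltr_pMr// ltr1n.
rewrite in_itv/= => yt; apply/negP; rewrite -leNgt.
have : gain i a y <= \sum_(a' : D) m i a a' * (K * e).
  apply: ler_sum => a' _.
  case: (boolP (a' \in T)) => [a'T|a'T]; last by rewrite m_out// !mul0r.
  move: yf; rewrite in_itv/= => /andP[ly yx].
  rewrite ler_wpM2l//; apply: le_trans (expected_payoff_le _ (ltW k_gt0) yx ji) _.
  apply: ler_pM => //; rewrite ?mulr_ge0 ?subr_ge0 ?fine_ge0 ?(ltW k_gt0)//.
    by rewrite ler_wpM2l ?(ltW k_gt0)// lerD2l lerN2.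
  rewrite -lee_fin fineK ?fin_num_measure//.
  by apply: le_trans (ltW (Ft a' a'T)); exact: lower_tail_le.
by rewrite -mulr_suml m_sum1// mul1r /e mulrCA divff ?mulr1// gt_eqF.
Unshelve. all: by end_near. Qed.

Lemma no_certain_bid_absurd : False.
Proof.
have [i [a [ti aT Fl]]] := atom_l.
have [y0 /andP[ly0 y0z] /(_ i a ti aT)[y0f g0]] := positive_gain.
have [j tj ji] := rival ti.
have lz : l < z by exact: lt_trans ly0 y0z.
have lx : l < x i by exact: lt_le_trans lz (top_le ti).
have lof : lo i <= l.
  by apply: (feasible_ge aT); rewrite lower_tail_atom// below_l.
have lf : l \in `[lo i, x i] by rewrite in_itv/= lof ltW.
(* The atom is a one-point set of positive probability, so [near_optimal] makes [l] itself
   optimal. *)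
have lopt y : y \in `[lo i, x i] -> gain i a y <= gain i a l.
  move=> yf; rewrite leNgt; apply/negP => ly.
  have [||y' [_ ->]] := @near_optimal i a [set l] y (gain i a l) aT _ Fl yf.
  - exact: measurable_set1.
  - by rewrite ly andbT; case/andP: (gain_bound aT lf).
  - by rewrite ltxx.
pose Q := \sum_(a' : D) m i a a' * fine (indep (F a') (rivals_le i l)).
have tie : gain i a l <= k * (x i - l) / 2 * Q.
  rewrite mulr_sumr; apply: ler_sum => a' _.
  case: (boolP (a' \in T)) => [a'T|a'T]; last by rewrite m_out// !mul0r mulr0.
  rewrite mulrCA ler_wpM2l//.
  by apply: (expected_payoff_tie (ltW k_gt0) (ltW lx) ji); exact: below_l.
(* Giving up a third of the margin leaves two thirds of it with an outright win on the event
   measured by [Q], against at most one half at [l]. Optimality of [l] then forces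
   [gain i a l <= 0], contrary to [g0]. *)
pose y1 := l + (x i - l) / 3.
have ly1 : l < y1 by rewrite ltrDl divr_gt0// subr_gt0.
have y1x : y1 <= x i by rewrite /y1; lra.
have y1f : y1 \in `[lo i, x i] by rewrite in_itv/= y1x (le_trans lof)// ltW.
have := gain_ge a ly1 y1x; rewrite -/Q => dev.
have devE : k * (x i - y1) * Q = 2 / 3 * (k * (x i - l) * Q) by rewrite /y1; field.
have tieE : k * (x i - l) / 2 * Q = 2^-1 * (k * (x i - l) * Q) by field.
have := lopt _ y1f; have := lopt _ y0f; rewrite devE in dev; rewrite tieE in tie.
lra.
Qed.

End NoCertainBid.

Lemma certain_bid : exists a i, a \in T /\ F a i `]-oo, z[%classic = 0%E.
Proof.
apply: contrapT => nai; apply: no_certain_bid_absurd => i a aT.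
by apply/eqP => Fz; apply: nai; exists a, i.
Qed.

End Bertrand.

(** * The continuation game *)

Section OrderStatistics.
Context (R : realType) (n : nat).
Implicit Types v b : 'I_n -> R.

(** Two distinct builders hold the two top positions of the sorted list, even when their values tie;
    they are the competitors of the Bertrand argument. *)
Lemma order_stat_top2 v : (2 <= n)%N -> exists i1 i2,
  [/\ i1 != i2, order_stat v 0 = v i1, order_stat v 1 = v i2,
      v i2 <= v i1 & forall j, v j <= v i1].
Proof.
move=> n2; rewrite /order_stat sort_map.
set t := sort _ _.
have st : size t = n by rewrite size_sort size_enum_ord.
have tot : total (relpre v >=%R) by move=> i j; exact: le_total.
have tr : transitive (relpre v >=%R) by move=> i j l /= ji /le_trans; apply.
have i0 : 'I_n by exact: Ordinal (ltnW n2).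
have srt : sorted (relpre v >=%R) t by exact: sort_sorted.
have t2 : (1 < size t)%N by rewrite st.
have t1 : (0 < size t)%N by rewrite ltnW.
exists (nth i0 t 0), (nth i0 t 1); rewrite !(nth_map i0)//.
have ut : uniq t by rewrite sort_uniq enum_uniq.
split => //.
- by rewrite nth_uniq.
- by have := sorted_leq_nth tr (fun i => lexx (v i)) i0 srt; apply.
- move=> j; have jt : j \in t by rewrite mem_sort mem_enum.
  rewrite -{1}(nth_index i0 jt).
  have := sorted_leq_nth tr (fun i => lexx (v i)) i0 srt; apply => //.
  by rewrite inE index_mem.
Qed.

Lemma max_bid_ge0 b : 0 <= max_bid b.
Proof. by rewrite /max_bid bigmax_idl le_max lexx. Qed.

Lemma le_max_bid b i : b i <= max_bid b.
Proof. exact: le_bigmax. Qed.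

Lemma max_bid_le b c : 0 <= c -> (forall i, b i <= c) -> max_bid b <= c.
Proof. by move=> c0 bc; apply/bigmax_leP; split. Qed.

End OrderStatistics.

Section AlmostEverywhere.
Context d (T : measurableType d) (R : realType) (P : {measure set T -> \bar R}).

Lemma ae_measure0 (Q : T -> Prop) (A : set T) : measurable A ->
  {ae P, forall w, Q w} -> (forall w, Q w -> ~ A w) -> P A = 0%E.
Proof.
move=> mA [N [mN PN sN]] QA; apply/eqP; rewrite -measure_le0 -PN.
rewrite le_measure ?inE//; apply: subset_trans sN => w Aw /= Qw.
exact: QA Qw Aw.
Qed.

End AlmostEverywhere.

(** * Revenue at reached histories, and optimality of stopping *)

Section Revenue.
Context (R : realType) (n : nat) (mu : probability (profile R n) R) (k2 : R).
Context (fast : 'I_n -> bool) (beta : 'I_n -> R -> R) (s : assessment R n).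
Context (k2_ge0 : 0 <= k2) (n_ge2 : (2 <= n)%N).
Context (values_ge0 : forall v, supp mu v -> forall i, 0 <= entry v i).
Context (beta_sep : separating mu beta).
Context (s_cons : consistent mu fast beta s).

Lemma measurable_set1_profile (v : profile R n) : measurable [set v].
Proof. exact: measurable_set1_tuple. Qed.

Lemma hist_inj v w : supp mu v -> supp mu w -> hist beta w = hist beta v ->
  w = v.
Proof.
move=> Vv Vw hwv; apply/eq_from_tnth => i; rewrite -!/(entry _ i).
have [mono _] := beta_sep i.
have sv : entry v i \in supp_at mu i by apply/mem_set; exists v.
have sw : entry w i \in supp_at mu i by apply/mem_set; exists w.
have hi : beta i (entry w i) = beta i (entry v i) := congr1 (fun h => h i) hwv.
case: (ltgtP (entry w i) (entry v i)) => // /mono => [/(_ sw sv)|/(_ sv sw)];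
  by rewrite hi ltxx.
Qed.

(** After CTN neither a fast nor a slow builder sees STOP, so the non-overbidding bound always
    applies. *)
Lemma feasible_ctn v i c :
  feasible (info_at fast beta i v (Some c)) =
  `[beta i (entry v i), entry v i]%classic.
Proof.
apply/seteqP; split => y; rewrite /feasible/= /observe in_itv/=.
  by case: (fast i); case: c => ? ? [-> ->].
by case/andP => -> yv; case: (fast i); case: c.
Qed.

Lemma node_revenue_ge0 v a : (0 <= node_revenue k2 fast beta s v a)%E.
Proof.
case: a => [c|] /=; last by rewrite lee_fin mulr_ge0 ?max_bid_ge0// /k1.
by apply: integral_ge0 => b _; rewrite lee_fin mulr_ge0 ?max_bid_ge0.
Qed.

(** Each builder almost surely bids at most its value, so almost surely no bid exceeds the highest
    value. *)
Lemma node_revenue_le v c : supp mu v ->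
  (node_revenue k2 fast beta s v (Some c) <=
   (k2 * order_stat (entry v) 0)%:E)%E.
Proof.
move=> Vv; have [i1 [_ [_ -> _ _ vle]]] := order_stat_top2 (entry v) n_ge2.
pose F j := bid2 s j (info_at fast beta j v (Some c)).
pose A j := `[beta j (entry v j), entry v j]%classic.
pose E : set (n.-tuple R) := [set b | forall j, A j (tnth b j)].
have mE : measurable E by apply: (measurable_box (A := A)) => j; exact: measurable_itv.
have PE : indep F E = 1%E.
  rewrite (@indep_box _ _ F A); last by move=> j; exact: measurable_itv.
  by rewrite big1// => j _; rewrite /A -(feasible_ctn _ _ c) (bid2_feasible s_cons).
have PEC : indep F (~` E) = 0%E by rewrite probability_setC// PE subee.
have := @integral_le_on _ _ _ (indep F) (fun b => k2 * max_bid (tnth b)) setT (~` E)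
  (k2 * entry v i1).
rewrite probability_setT mulr1; apply => //.
- by move=> b; rewrite mulr_ge0 ?max_bid_ge0.
- exact: measurableC.
- by rewrite mulr_ge0// values_ge0.
- move=> b /contrapT Eb _; rewrite ler_wpM2l// max_bid_le ?values_ge0// => j.
  by have := Eb j; rewrite /A/= in_itv/= => /andP[_ /le_trans]; apply.
- by move=> b /(_ I).
Qed.

Lemma node_revenue_ge v c i z : 0 <= z ->
  bid2 s i (info_at fast beta i v (Some c)) `]-oo, z[%classic = 0%E ->
  ((k2 * z)%:E <= node_revenue k2 fast beta s v (Some c))%E.
Proof.
move=> z0 Fz.
pose F j := bid2 s j (info_at fast beta j v (Some c)).
pose E : set (n.-tuple R) := [set b | (~` `]-oo, z[%classic) (tnth b i)].
have mz : measurable (~` `]-oo, z[%classic : set R) by exact: measurableC.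
have mE : measurable E by exact: measurable_slab.
have PE : indep F E = 1%E.
  by rewrite indep_slab// probability_setC// [X in (1 - X)%E]Fz sube0.
have := @integral_ge_on _ _ _ (indep F) (fun b => k2 * max_bid (tnth b)) E (k2 * z).
rewrite PE mulr1; apply => //.
- by move=> b; rewrite mulr_ge0 ?max_bid_ge0.
- by rewrite mulr_ge0.
- move=> b /= /negP; rewrite in_itv/= -leNgt => zb.
  by rewrite ler_wpM2l// (le_trans zb)// le_max_bid.
Qed.

(** By [hist_inj] the history determines [v], so the proposer's belief is concentrated there. *)
Lemma revenueE v a : supp mu v ->
  revenue mu k2 fast beta s (hist beta v) a = node_revenue k2 fast beta s v a.
Proof.
move=> Vv; rewrite /revenue (integral_point (v := v))//.
- by rewrite [X in (_ * X)%E]probability_setT mule1.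
- exact: measurable_set1_profile.
- apply: (ae_measure0 _ (pbelief_node s_cons Vv)).
    by apply: measurableC; exact: measurable_set1_profile.
  by move=> w [Vw hw]; apply; exact: hist_inj hw.
- case: a => [c|//]; rewrite ge0_fin_numE ?node_revenue_ge0//.
  exact: le_lt_trans (node_revenue_le c Vv) (ltry _).
Qed.

Lemma stop_optimal v : (k2%:E <= k2_lower mu beta)%E -> supp mu v ->
  proposer_optimal mu k2 fast beta s (hist beta v) stop.
Proof.
move=> k2low Vv a; rewrite !revenueE//; case: a => [c|//].
apply: le_trans (node_revenue_le c Vv) _; rewrite lee_fin /k1 mul1r.
(* A profile without a positive value does not enter [k2_lower]; continuing then earns at most 0. *)
have [v0|v0] := leP (order_stat (entry v) 0) 0.
  by apply: le_trans (max_bid_ge0 _); rewrite mulr_ge0_le0.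
rewrite -ler_pdivlMr// -lee_fin; apply: le_trans k2low _.
by apply: ereal_inf_lbound; exists v => //; rewrite /k1 mul1r.
Qed.

End Revenue.

(** * Play after full public disclosure *)

Section FullDisclosure.
Context (R : realType) (n : nat) (mu : probability (profile R n) R) (k2 : R).
Context (beta : 'I_n -> R -> R) (s : assessment R n).
Context (k2_ge0 : 0 <= k2) (k2_le_k1 : k2 <= k1 R) (n_ge2 : (2 <= n)%N).
Context (values_ge0 : forall v, supp mu v -> forall i, 0 <= entry v i).
Context (beta_sep : separating mu beta).
Context (s_rat : rational_continuation mu k2 xpredT beta s).
Context (v : profile R n).
Context (Vv : supp mu v).

Local Notation infoset := (info_at xpredT beta).

Let s_cons : consistent mu xpredT beta s. Proof. by case: s_rat. Qed.

(** The broadcast alone identifies the history, since [disclose] yields [Some] everywhere only if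
    nothing is withheld. The private messages to the others stay open, hence the existential over
    [Sp']. *)
Lemma hist_of_full_disclosure Sp i w a :
  infoset i w a = infoset i v (full_disclosure Sp) ->
  hist beta w = hist beta v /\ exists Sp', a = full_disclosure Sp'.
Proof.
rewrite /info_at /observe; case: a => [[Sc Sp']|//] [_ _ hSc _].
have Sc_all j : j \in Sc.
  have := congr1 (fun f => f j) hSc; rewrite /disclose inE.
  by case: (j \in Sc).
split.
  apply/funext => j; have := congr1 (fun f => f j) hSc.
  by rewrite /disclose inE Sc_all => -[].
by exists Sp'; congr (Some (_, _)); apply/setP => j; rewrite inE Sc_all.
Qed.

Lemma belief_out Sp i a : (forall Sp', a <> full_disclosure Sp') ->
  bbelief s i (infoset i v (full_disclosure Sp)) a setT = 0%E.
Proof.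
move=> aF; apply: (ae_measure0 _ (bbelief_node s_cons i _ a Vv)) => //.
by move=> w [_ /hist_of_full_disclosure[_ [Sp' /aF]]].
Qed.

Lemma belief_value Sp i a :
  bbelief s i (infoset i v (full_disclosure Sp)) a (~` [set v]) = 0%E.
Proof.
apply: (ae_measure0 _ (bbelief_node s_cons i _ a Vv)) => //.
  by apply: measurableC; exact: measurable_set1_profile.
move=> w [Vw /hist_of_full_disclosure[hwv _]]; apply.
exact: (hist_inj beta_sep Vv Vw hwv).
Qed.

Lemma belief_fin Sp i a :
  bbelief s i (infoset i v (full_disclosure Sp)) a setT \is a fin_num.
Proof.
rewrite ge0_fin_numE//; apply: (@le_lt_trans _ _ 1%E); last exact: ltry.
rewrite -(bbelief_sum1 s_cons i (full_disclosure Sp) Vv) (bigD1 a)//=.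
by rewrite leeDl// sume_ge0.
Qed.

(** * Sets of full disclosures that are closed under the builders' beliefs *)

Section Beliefs.
Context (T : {set decision n}).
Context (T_full : forall a, a \in T -> exists Sp, a = full_disclosure Sp).
Context (T_closed : forall i a a', a \in T -> a' \notin T ->
  bbelief s i (infoset i v a) a' setT = 0%E).

Let F (a : decision n) (j : 'I_n) : probability R R := bid2 s j (infoset j v a).
Let m (i : 'I_n) (a a' : decision n) : R :=
  fine (bbelief s i (infoset i v a) a' setT).

(** The belief about values is a point mass at [v], so only the weights [m] on decisions remain and
    the Bertrand setting applies. *)
Lemma builder_payoff_gain i a y : a \in T -> y <= entry v i ->
  builder_payoff mu k2 xpredT beta s i (infoset i v a) y =
  (gain F m (entry v) k2 i a y)%:E.
Proof.
move=> aT yv; rewrite /builder_payoff /gain -sumEFin; apply: eq_bigr => a' _.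
have [Sp aE] := T_full aT.
have fin : node_payoff k2 xpredT beta s i y v a' \is a fin_num.
  by case: a' => [c|//]; exact: expected_payoff_fin.
rewrite (integral_point (v := v))//.
- rewrite EFinM muleC /m.
  case: (boolP (a' \in T)) => a'T; last by rewrite (T_closed i aT a'T) fine0 !mul0e.
  rewrite !fineK.
  + by have [Sp' ->] := T_full a'T.
  + exact: expected_payoff_fin.
  + by rewrite aE belief_fin.
- exact: measurable_set1_profile.
- by rewrite aE belief_value.
Qed.

Lemma full_disclosure_improves : (exists a, a \in T) ->
  0 < order_stat (entry v) 1 ->
  max_bid (hist beta v) < k2 * order_stat (entry v) 1 ->
  exists2 a, a \in T &
    (revenue mu k2 xpredT beta s (hist beta v) stop <
     revenue mu k2 xpredT beta s (hist beta v) a)%E.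
Proof.
have [i1 [i2 [i12 _ ]]] := order_stat_top2 (entry v) n_ge2.
set z := order_stat _ _ => zE v21 _ T0 z0 Mz.
have k2_gt0 : 0 < k2.
  by rewrite -(pmulr_lgt0 _ z0); exact: le_lt_trans (max_bid_ge0 _) Mz.
pose lo i := beta i (entry v i).
(* Every stage-1 bid lies below [k2 * z], which is at most [z] because [k2 <= 1]. *)
have lo_z i : lo i < z.
  apply: le_lt_trans (le_max_bid (hist beta v) i) _.
  by apply: lt_le_trans Mz _; rewrite ler_piMl// ltW.
have feas i a : a \in T ->
    feasible (infoset i v a) = `[lo i, entry v i]%classic.
  by move=> /T_full[Sp ->]; exact: feasible_ctn.
have [|||||||||||a [i [aT Fa]]] :=
  @certain_bid R n (decision n) T F m (entry v) lo k2 z i1 i2.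
- by [].
- by [].
- by [].
- by rewrite zE.
- by rewrite zE.
- exact: lo_z.
- by move=> i a a'; rewrite fine_ge0.
- by move=> i a a' aT a'T; rewrite /m T_closed.
- move=> i a aT; apply: EFin_inj; rewrite -sumEFin.
  rewrite -(bbelief_sum1 s_cons i a Vv); apply: eq_bigr => a' _.
  by have [Sp ->] := T_full aT; rewrite fineK ?belief_fin.
- by move=> i a aT; rewrite -(feas i a aT) (bid2_feasible s_cons).
- move=> i a aT y; rewrite in_itv/= => /andP[ly yv].
  have [_ /(_ i v a Vv y)] := s_rat.
  rewrite (feas i a aT) /= in_itv/= ly yv builder_payoff_gain// => /(_ isT) H.
  apply: (le_trans H); rewrite le_eqVlt; apply/orP; left; apply/eqP.
  apply: eq_integral => t; rewrite inE/= in_itv/= => /andP[_ tv].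
  exact: builder_payoff_gain.
exists a => //; rewrite !(revenueE k2_ge0 n_ge2 values_ge0 beta_sep s_cons)//.
have [Sp aE] := T_full aT; rewrite aE in Fa *.
apply: lt_le_trans (node_revenue_ge k2_ge0 (ltW z0) Fa).
by rewrite lte_fin /k1 mul1r.
Qed.

End Beliefs.
End FullDisclosure.

(** The infimum supplies a profile whose ratio is below [k2]; it depends on [beta] only, so it
    serves every continuation play at once. *)
Lemma full_disclosure_beats_stop (R : realType) (n : nat)
    (mu : probability (profile R n) R) (k2 : R) (beta : 'I_n -> R -> R) :
  (2 <= n)%N -> (forall v, supp mu v -> forall i, 0 <= entry v i) ->
  0 <= k2 -> k2 <= k1 R -> separating mu beta ->
  (k2_upper mu beta < k2%:E)%E ->
  exists2 v, supp mu v &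
    forall s : assessment R n,
      rational_continuation mu k2 xpredT beta s ->
      (forall Sp, messages_understood xpredT beta s v (full_disclosure Sp) ->
        (revenue mu k2 xpredT beta s (hist beta v) stop <
         revenue mu k2 xpredT beta s (hist beta v) (full_disclosure Sp))%E) /\
      (exists Sp,
        (revenue mu k2 xpredT beta s (hist beta v) stop <
         revenue mu k2 xpredT beta s (hist beta v) (full_disclosure Sp))%E).
Proof.
move=> n2 v_ge0 k0 k1' sep /ereal_inf_lt[_ [v [Vv z0] <-]].
rewrite lte_fin /k1 mul1r ltr_pdivrMr// => Mz.
exists v => // s rat; split.
  (* With messages understood, a single decision is closed under beliefs, so the improving decision
     is the given one. *)
  move=> Sp und; pose T := [set full_disclosure Sp]%SET.
  have [|||||_ /set1P->//] :=
    @full_disclosure_improves _ _ _ _ _ s k0 k1' n2 v_ge0 sep rat v Vv T.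
  - by move=> a /set1P->; exists Sp.
  - move=> i a a' /set1P-> a'T; apply: und => a'E.
    by move: a'T; rewrite a'E set11.
  - by exists (full_disclosure Sp); exact: set11.
  - exact: z0.
  - exact: Mz.
(* In general all full disclosures together are closed under beliefs, and some choice of private
   messages improves on stopping. *)
pose T := [set full_disclosure Sp | Sp in [set: {ffun 'I_n -> {set 'I_n}}]]%SET.
have Tfull a : a \in T -> exists Sp, a = full_disclosure Sp.
  by case/imsetP => Sp _ ->; exists Sp.
have [|||||_ /Tfull[Sp ->] H] :=
  @full_disclosure_improves _ _ _ _ _ s k0 k1' n2 v_ge0 sep rat v Vv T.
- exact: Tfull.
- move=> i a a' /Tfull[Sp ->] a'T; apply: (belief_out rat Vv) => Sp' a'E.
  by move: a'T; rewrite a'E imset_f.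
- by exists (full_disclosure [ffun=> [set: 'I_n]%SET]); apply: imset_f; rewrite inE.
- exact: z0.
- exact: Mz.
by exists Sp.
Qed.

(** * The symmetric first-price auction on product support *)

Section SymmetricFPA.
Context (R : realType) (n : nat) (mu : probability (profile R n) R).
Context (VV : set R) (b : R -> R).
Context (n_ge2 : (2 <= n)%N).
Context (beta_sep : separating mu (fun=> b)).
Context (supp_prod : supp mu = [set v | forall i, VV (entry v i)]).

(** Product support contains these diagonal profiles, whose two top values coincide; they realise
    every ratio in [k2_star]. *)
Let const (x : R) : profile R n := [tuple x | i < n].

Let entry_const x i : entry (const x) i = x.
Proof. exact: tnth_mktuple. Qed.

Let supp_const x : VV x -> supp mu (const x).
Proof. by move=> Vx; rewrite supp_prod => i; rewrite entry_const. Qed.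

Let order_stat_const x : order_stat (entry (const x)) 0 = x /\
  order_stat (entry (const x)) 1 = x.
Proof.
have [i1 [i2 [_ -> -> _ _]]] := order_stat_top2 (entry (const x)) n_ge2.
by rewrite !entry_const.
Qed.

Let max_bid_fpa v : supp mu v ->
  max_bid (hist (fun=> b) v) = b (order_stat (entry v) 0) /\
  VV (order_stat (entry v) 0).
Proof.
move=> Vv; have [i1 [_ [_ -> _ _ vle]]] := order_stat_top2 (entry v) n_ge2.
have VVv i : VV (entry v i) by move: Vv; rewrite supp_prod; apply.
split=> //; have [mono pos] := beta_sep i1.
have inV x : VV x -> x \in supp_at mu i1.
  by move=> Vx; apply/mem_set; exists (const x); [exact: supp_const|exact: entry_const].
apply/eqP; rewrite eq_le (le_max_bid (hist (fun=> b) v) i1) andbT.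
apply: max_bid_le => [|j]; first by case/andP: (pos _ (inV _ (VVv i1))).
have := vle j; rewrite le_eqVlt => /predU1P[ji|ji]; first by rewrite /hist ji.
by apply/ltW/mono => //; exact: inV.
Qed.

Let max_bid_const x : VV x -> max_bid (hist (fun=> b) (const x)) = b x.
Proof.
by move=> /supp_const/max_bid_fpa[-> _]; case: (order_stat_const x) => ->.
Qed.

Lemma k2_lower_fpa : k2_lower mu (fun=> b) = k2_star VV b.
Proof.
rewrite /k2_lower /k2_star; congr (ereal_inf _).
apply/seteqP; split => [_ [v [Vv v0] <-]|_ [x [Vx x0] <-]].
  have [-> Vv1] := max_bid_fpa Vv.
  by exists (order_stat (entry v) 0).
have [q0 _] := order_stat_const x.
exists (const x); last by rewrite q0 max_bid_const.
by split; [exact: supp_const|rewrite q0].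
Qed.

(** Diagonal profiles give one inequality. For the other, the highest bid is [b] at the highest
    value, and dividing it by the second-highest value instead of the highest can only raise the
    ratio. *)
Lemma k2_upper_fpa : k2_upper mu (fun=> b) = k2_star VV b.
Proof.
apply/eqP; rewrite eq_le; apply/andP; split; apply/ereal_infP => y.
  move=> [x [Vx x0] <-]; have [_ q1] := order_stat_const x.
  apply: ereal_inf_lbound.
  exists (const x); last by rewrite q1 max_bid_const.
  by split; [exact: supp_const|rewrite q1].
move=> [v [Vv v0] <-]; have [-> Vv1] := max_bid_fpa Vv.
have [i1 [i2 [_ e0 e1 v21 _]]] := order_stat_top2 (entry v) n_ge2.
have o10 : order_stat (entry v) 1 <= order_stat (entry v) 0 by rewrite e0 e1.
have q0 := lt_le_trans v0 o10.
apply: (@le_trans _ _ (k1 R * (b (order_stat (entry v) 0) / order_stat (entry v) 0))%:E).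
  by apply: ereal_inf_lbound; exists (order_stat (entry v) 0).
rewrite lee_fin /k1 !mul1r ler_wpM2l ?lef_pV2//.
by rewrite -(max_bid_fpa Vv).1 max_bid_ge0.
Qed.

End SymmetricFPA.

Theorem proposition3 (R : realType) (n : nat) (n_ge2 : (2 <= n)%N)
    (mu : probability (profile R n) R) (k2 : R) (beta : 'I_n -> R -> R)
    (values_ge0 : forall v, supp mu v -> forall i, 0 <= entry v i)
    (k2_ge0 : 0 <= k2) (k2_le_k1 : k2 <= k1 R)
    (beta_sep : separating mu beta) :
  (* (i) *)
  ((k2%:E <= k2_lower mu beta)%E ->
    forall (fast : 'I_n -> bool) (s : assessment R n),
      rational_continuation mu k2 fast beta s ->
      forall v, supp mu v ->
        proposer_optimal mu k2 fast beta s (hist beta v) stop) /\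
  (* (ii) *)
  ((k2_upper mu beta < k2%:E)%E ->
    exists2 v, supp mu v &
      forall s : assessment R n,
        rational_continuation mu k2 xpredT beta s ->
        (forall Sp, messages_understood xpredT beta s v (full_disclosure Sp) ->
          (revenue mu k2 xpredT beta s (hist beta v) stop <
           revenue mu k2 xpredT beta s (hist beta v) (full_disclosure Sp))%E) /\
        (exists Sp,
          (revenue mu k2 xpredT beta s (hist beta v) stop <
           revenue mu k2 xpredT beta s (hist beta v) (full_disclosure Sp))%E)) /\
  (* first-price auction *)
  (forall (VV : set R) (bFPA : R -> R),
    beta = (fun _ => bFPA) ->
    supp mu = [set v | forall i, VV (entry v i)] ->
    efficient mu beta ->
    fpa_equilibrium mu beta ->
    [/\ k2_lower mu beta = k2_star VV bFPA,
        k2_upper mu beta = k2_star VV bFPA,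
        (k2%:E <= k2_star VV bFPA)%E ->
          forall (fast : 'I_n -> bool) (s : assessment R n),
            rational_continuation mu k2 fast beta s ->
            forall v, supp mu v ->
              proposer_optimal mu k2 fast beta s (hist beta v) stop
      & (k2_star VV bFPA < k2%:E)%E ->
          ~ exists s : assessment R n,
              [/\ rational_continuation mu k2 xpredT beta s,
                  proposer_rational mu k2 xpredT beta s
                & immediate_stop mu beta s] ]).
Proof.
have stop_opt : (k2%:E <= k2_lower mu beta)%E ->
    forall (fast : 'I_n -> bool) (s : assessment R n),
      rational_continuation mu k2 fast beta s ->
      forall v, supp mu v ->
        proposer_optimal mu k2 fast beta s (hist beta v) stop.
  by move=> k2l fast s [s_cons _] v Vv; exact: stop_optimal.
have disclose_opt := full_disclosure_beats_stop n_ge2 values_ge0 k2_ge0 k2_le_k1 beta_sep.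
split=> //; split=> // VV b betaE supp_prod _ _.
have lowE : k2_lower mu beta = k2_star VV b.
  by rewrite betaE in beta_sep *; exact: k2_lower_fpa.
have upE : k2_upper mu beta = k2_star VV b.
  by rewrite betaE in beta_sep *; exact: k2_upper_fpa.
split=> //; first by rewrite -lowE.
(* STOP has probability 1 at the witness history, so rationality makes it optimal there, against the
   improving disclosure. *)
rewrite -upE => /disclose_opt[v Vv better] [s [rat prop_rat stops]].
have [_ [Sp]] := better s rat; apply/negP; rewrite -leNgt.
by apply: (prop_rat v stop Vv); rewrite stops.
Qed.
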